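(* Let $\mathcal A,\mathcal B,\mathcal D$ be $^*$-algebras over $\mathsf C$. Let $\mathfrak X$ be a $(\mathcal B$-$\mathcal A)$-equivalence bimodule which satisfies P1--P3, and let $\mathfrak X'$ be an $(\mathcal A$-$\mathcal D)$-equivalence bimodule which satisfies Q1--Q3. Then $\mathcal B$ and $\mathcal D$ are formally Morita equivalent.
   Context: $\mathsf R$ is an ordered ring (commutative ring with $1\ne0$ and a subset $\mathsf P$ closed under sums and products such that $\mathsf R$ is the disjoint union $-\mathsf P\cup\{0\}\cup\mathsf P$), and $\mathsf C=\mathsf R(\mathrm i)=\mathsf R\oplus\mathrm i\mathsf R$, $\mathrm i^2=-1$, with the usual conjugation. A $^*$-algebra over $\mathsf C$ is an associative (not necessarily unital) $\mathsf C$-algebra with an antilinear involution satisfying $(AB)^*=B^*A^*$. A linear $\omega:\mathcal A\to\mathsf C$ is positive if $\omega(A^*A)\ge0$ for all $A$; a Hermitian $A$ is positive ($A\ge0$) if $\omega(A)\ge0$ for all positive linear functionals $\omega$. A pre-Hilbert space over $\mathsf C$ is a $\mathsf C$-module with a Hermitian inner product (linear in the second argument), $\langle\phi,\phi\rangle\ge0$, and $\langle\phi,\phi\rangle=0\Rightarrow\phi=0$. A $^*$-representation is a $^*$-homomorphism into the adjointable endomorphisms of a pre-Hilbert space. A $(\mathcal B$-$\mathcal A)$-equivalence bimodule is a $\mathsf C$-module $\mathfrak X$ with commuting left $\mathcal B$- and right $\mathcal A$-actions and maps $\langle\cdot,\cdot\rangle_{\mathcal A}:\mathfrak X\times\mathfrak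 X\to\mathcal A$, ${}_{\mathcal B}\langle\cdot,\cdot\rangle:\mathfrak X\times\mathfrak X\to\mathcal B$ such that: E1) X1) $\langle\cdot,\cdot\rangle_{\mathcal A}$ is $\mathsf C$-linear in the second argument; X2) $\langle x,y\rangle_{\mathcal A}=\langle y,x\rangle_{\mathcal A}^*$; X3) $\langle x,y\cdot A\rangle_{\mathcal A}=\langle x,y\rangle_{\mathcal A}A$; X4) $\langle x,x\rangle_{\mathcal A}\ge0$; X5) $\langle x,B\cdot y\rangle_{\mathcal A}=\langle B^*\cdot x,y\rangle_{\mathcal A}$; X6) the $\mathsf C$-span of all $\langle x,y\rangle_{\mathcal A}$ is $\mathcal A$. E2) Y1) ${}_{\mathcal B}\langle\cdot,\cdot\rangle$ is $\mathsf C$-linear in the first argument; Y2) ${}_{\mathcal B}\langle x,y\rangle={}_{\mathcal B}\langle y,x\rangle^*$; Y3) ${}_{\mathcal B}\langle B\cdot x,y\rangle=B\,{}_{\mathcal B}\langle x,y\rangle$; Y4) ${}_{\mathcal B}\langle x,x\rangle\ge0$; Y5) ${}_{\mathcal B}\langle x\cdot A,y\rangle={}_{\mathcal B}\langle x,y\cdot A^*\rangle$; Y6) the $\mathsf C$-span of all ${}_{\mathcal B}\langle x,y\rangle$ is $\mathcal B$. E3) ${}_{\mathcal B}\langle x,y\rangle\cdot z=x\cdot\langle y,z\rangle_{\mathcal A}$. E4) P): for every $^*$-representation $(\mathfrak H,\pi)$ of $\mathcal A$ the form $\langle x\otimes\psi,y\otimes\phi\rangle=\langle\psi,\pi(\langle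 x,y\rangle_{\mathcal A})\phi\rangle$ on $\mathfrak X\otimes_{\mathcal A}\mathfrak H$ is positive semi-definite; and Q): P holds for the conjugate $(\mathcal A$-$\mathcal B)$-bimodule $\overline{\mathfrak X}$ (conjugate $\mathsf C$-module, $A\bar x=\overline{xA^*}$, $\bar xB=\overline{B^*x}$) with $\langle\bar x,\bar y\rangle_{\mathcal B}={}_{\mathcal B}\langle x,y\rangle$. $\mathcal A$ and $\mathcal B$ are formally Morita equivalent if a $(\mathcal B$-$\mathcal A)$-equivalence bimodule exists. Conditions P1--P3 on a $(\mathcal B$-$\mathcal A)$-bimodule $\mathfrak X$: P1) $\mathfrak X=\bigoplus_{i\in I}\mathfrak X^{(i)}$ with $\mathfrak X^{(i)}\perp\mathfrak X^{(j)}$ for $i\ne j$ with respect to $\langle\cdot,\cdot\rangle_{\mathcal A}$. P2) The right $\mathcal A$-action preserves this direct sum. P3) Each $\mathfrak X^{(i)}$ is a directed union $\bigcup_{\alpha}\mathfrak X^{(i)}_\alpha$ of submodules ($\mathfrak X^{(i)}_\alpha\subseteq\mathfrak X^{(i)}_\beta$ for $\alpha\le\beta$ in a directed set) with vectors $\Omega^{(i)}_\alpha\in\mathfrak X^{(i)}_\alpha$ such that every $x\in\mathfrak X^{(i)}_\alpha$ has the form $\Omega^{(i)}_\alpha\cdot A$ with $A\in\mathcal A$. Conditions Q1--Q3 are the analogous conditions (with an independent decomposition) with respect to ${}_{\mathcal B}\langle\cdot,\cdot\rangle$ and the left $\mathcal B$-action; for $\mathfrak X'$ they refer to the $\mathcal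 A$-valued inner product ${}_{\mathcal A}\langle\cdot,\cdot\rangle$ and left $\mathcal A$-action. *)

(* Defs.v *)
From HB Require Import structures.
From mathcomp Require Import all_boot all_order all_algebra generic_quotient.
From mathcomp Require Import complex.
From mathcomp Require Import boolp classical_sets functions cardinality fsbigop.

Set Implicit Arguments.
Unset Strict Implicit.
Unset Printing Implicit Defensive.

Import Order.TTheory GRing.Theory Num.Theory ComplexField.

Local Open Scope classical_set_scope.
Local Open Scope ring_scope.
Local Open Scope complex_scope.
Local Open Scope quotient_scope.

(* An ordered ring (commutative, nontrivial, with a positive cone) has no zero
   divisors: it is a [realDomainType].  The library gives [R[i]] a ring
   structure only when [R] is a field, hence the alias [cext R]. *)
Definition cext (R : realDomainType) : Type := R[i].

HB.instance Definition _ (R : realDomainType) :=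
  GRing.Zmodule.copy (cext R) R[i].

Section CextRing.
Variable R : realDomainType.

Fact cext_mul1 : left_id (1%:C : cext R) (@mulc R).
Proof. by move=> [a b] /=; rewrite !mul1r !mul0r subr0 addr0. Qed.

Fact cext_mulDl :
  left_distributive (@mulc R : cext R -> cext R -> cext R) +%R.
Proof.
move=> [a b] [c d] [e f]; rewrite -![_ + _]/(addc _ _) /=.
by rewrite !mulrDl !opprD -!addrA; congr ((_ + _) +i* (_ + _)); rewrite addrCA.
Qed.

Fact cext_nonzero1 : (1%:C : cext R) != 0.
Proof. by rewrite eq_complex /= oner_eq0. Qed.

HB.instance Definition _ := GRing.Zmodule_isComNzRing.Build (cext R)
  (@mulcA R) (@mulcC R) cext_mul1 cext_mulDl cext_nonzero1.

Definition cconj (z : cext R) : cext R := complex.Re z -i* complex.Im z.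

Fact cconj_is_additive : zmod_morphism cconj.
Proof. by move=> [a b] [c d]; congr (_ +i* _); exact: opprD. Qed.

Fact cconj_is_multiplicative : monoid_morphism cconj.
Proof.
split=> [|[a b] [c d]]; first by rewrite /cconj /= oppr0.
by congr (_ +i* _) => /=; rewrite ?mulrNN // opprD mulrN mulNr.
Qed.

HB.instance Definition _ :=
  GRing.isZmodMorphism.Build (cext R) (cext R) cconj cconj_is_additive.
HB.instance Definition _ :=
  GRing.isMonoidMorphism.Build (cext R) (cext R) cconj cconj_is_multiplicative.

Lemma cconjK : involutive cconj.
Proof. by move=> [a b]; rewrite /cconj /= opprK. Qed.

Definition cge0 (z : cext R) : bool :=
  (complex.Im z == 0) && (0 <= complex.Re z).

End CextRing.

Record star_algebra (R : realDomainType) := StarAlgebra {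
  sa_sort :> lmodType (cext R);
  sa_mul : sa_sort -> sa_sort -> sa_sort;
  sa_star : sa_sort -> sa_sort;
  sa_mulA : associative sa_mul;
  sa_mul_linearl : forall a, linear (sa_mul^~ a);
  sa_mul_linearr : forall a, linear (sa_mul a);
  sa_star_antilinear : forall c a b,
    sa_star (c *: a + b) = cconj c *: sa_star a + sa_star b;
  sa_starK : involutive sa_star;
  sa_starM : forall a b, sa_star (sa_mul a b) = sa_mul (sa_star b) (sa_star a)
}.

Definition positive_functional (R : realDomainType) (A : star_algebra R)
    (w : {scalar A}) : Prop :=
  forall a : A, cge0 (w (sa_mul (sa_star a) a)).

Definition positive_elt (R : realDomainType) (A : star_algebra R) (a : A) :
    Prop :=
  sa_star a = a /\
  forall w : {scalar A}, positive_functional w -> cge0 (w a).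

Record prehilbert (R : realDomainType) := PreHilbert {
  ph_sort :> lmodType (cext R);
  ph_inner : ph_sort -> ph_sort -> cext R;
  ph_linear : forall phi, scalar (ph_inner phi);
  ph_herm : forall phi psi, ph_inner phi psi = cconj (ph_inner psi phi);
  ph_ge0 : forall phi, cge0 (ph_inner phi phi);
  ph_eq0 : forall phi, ph_inner phi phi = 0 -> phi = 0
}.

Definition adjoint_of (R : realDomainType) (H : prehilbert R)
    (S T : H -> H) : Prop :=
  forall phi psi, ph_inner (S phi) psi = ph_inner phi (T psi).

Record star_representation (R : realDomainType) (A : star_algebra R) :=
    StarRepresentation {
  rep_space :> prehilbert R;
  rep : A -> rep_space -> rep_space;
  rep_endo : forall a, linear (rep a);
  rep_linear : forall phi, linear (rep^~ phi);
  rep_mul : forall a b phi, rep (sa_mul a b) phi = rep a (rep b phi);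
  rep_star : forall a, adjoint_of (rep a) (rep (sa_star a))
}.

Record bimodule (R : realDomainType) (B A : star_algebra R) := Bimodule {
  bm_sort :> lmodType (cext R);
  lact : B -> bm_sort -> bm_sort;
  ract : bm_sort -> A -> bm_sort;
  lact_linear : forall b, linear (lact b);
  lact_linearl : forall x, linear (lact^~ x);
  lact_mul : forall b b' x, lact (sa_mul b b') x = lact b (lact b' x);
  ract_linear : forall a, linear (ract^~ a);
  ract_linearr : forall x, linear (ract x);
  ract_mul : forall x a a', ract x (sa_mul a a') = ract (ract x a) a';
  lract_comm : forall b x a, ract (lact b x) a = lact b (ract x a)
}.

Definition conj_module (R : realDomainType) (X : lmodType (cext R)) : Type := X.

Section ConjModule.
Variables (R : realDomainType) (X : lmodType (cext R)).

HB.instance Definition _ := GRing.Zmodule.copy (conj_module X) X.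

Definition conj_scale (c : cext R) (x : conj_module X) : conj_module X :=
  cconj c *: (x : X).

Fact conj_scalerA a b v :
  conj_scale a (conj_scale b v) = conj_scale (a * b) v.
Proof. by rewrite /conj_scale scalerA rmorphM. Qed.

Fact conj_scale1r : left_id 1 conj_scale.
Proof. by move=> v; rewrite /conj_scale rmorph1 scale1r. Qed.

Fact conj_scalerDr : right_distributive conj_scale +%R.
Proof. by move=> c u v; rewrite /conj_scale scalerDr. Qed.

Fact conj_scalerDl v : {morph conj_scale^~ v : a b / a + b}.
Proof. by move=> a b; rewrite /conj_scale rmorphD scalerDl. Qed.

HB.instance Definition _ := GRing.Zmodule_isLmodule.Build (cext R)
  (conj_module X) conj_scalerA conj_scale1r conj_scalerDr conj_scalerDl.

End ConjModule.

Section ConjBimodule.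
Variables (R : realDomainType) (B A : star_algebra R) (X : bimodule B A).
Local Notation cX := (conj_module X).

Definition conj_lact (a : A) (x : cX) : cX := ract (x : X) (sa_star a).
Definition conj_ract (x : cX) (b : B) : cX := lact (sa_star b) (x : X).

Fact conj_lact_linear a : linear (conj_lact a).
Proof. by move=> c x y; exact: (ract_linear (sa_star a)). Qed.

Fact conj_lact_linearl x : linear (conj_lact^~ x).
Proof.
by move=> c a b; rewrite /conj_lact sa_star_antilinear; exact: ract_linearr.
Qed.

Fact conj_lact_mul a a' x :
  conj_lact (sa_mul a a') x = conj_lact a (conj_lact a' x).
Proof. by rewrite /conj_lact sa_starM ract_mul. Qed.

Fact conj_ract_linear b : linear (conj_ract^~ b).
Proof. by move=> c x y; exact: (lact_linear (sa_star b)). Qed.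

Fact conj_ract_linearr x : linear (conj_ract x).
Proof.
move=> c a b; rewrite /conj_ract sa_star_antilinear.
exact: (lact_linearl (x : X)).
Qed.

Fact conj_ract_mul x b b' :
  conj_ract x (sa_mul b b') = conj_ract (conj_ract x b) b'.
Proof. by rewrite /conj_ract sa_starM lact_mul. Qed.

Fact conj_lract_comm a x b :
  conj_ract (conj_lact a x) b = conj_lact a (conj_ract x b).
Proof. by rewrite /conj_ract /conj_lact lract_comm. Qed.

Definition conj_bimodule : bimodule A B :=
  @Bimodule R A B cX conj_lact conj_ract conj_lact_linear conj_lact_linearl
    conj_lact_mul conj_ract_linear conj_ract_linearr conj_ract_mul
    conj_lract_comm.

End ConjBimodule.

(* [tensor r l] is the tensor product of [X] and [Y] balanced over [A], where
   [A] acts on the right of [X] by [r] and on the left of [Y] by [l].  Its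
   elements are the finite formal sums of pairs [(x, y)], two of them being
   identified when no bilinear balanced map to a module separates them.
   The universal property is [pure_balanced], [tensor_lift_linear],
   [tensor_lift_pure] and [tensor_eq_lin] below. *)
Section Tensor.
Variables (K : comNzRingType) (A : Type) (X Y : lmodType K).
Variables (r : X -> A -> X) (l : A -> Y -> Y).

Definition balanced (V : lmodType K) (f : X -> Y -> V) : Prop :=
  [/\ forall x, linear (f x), forall y, linear (f^~ y)
    & forall x a y, f (r x a) y = f x (l a y)].

Definition formal_eval (V : lmodType K) (f : X -> Y -> V) (s : seq (X * Y)) :
    V :=
  \sum_(p <- s) f p.1 p.2.

Definition tensor_eqv (s t : seq (X * Y)) : bool :=
  `[< forall (V : lmodType K) (f : X -> Y -> V), balanced f ->
        formal_eval f s = formal_eval f t >].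

Fact tensor_eqv_refl : reflexive tensor_eqv.
Proof. by move=> s; apply/asboolP. Qed.

Fact tensor_eqv_sym : symmetric tensor_eqv.
Proof.
by move=> s t; apply/asboolP/asboolP => st V f fb; rewrite st.
Qed.

Fact tensor_eqv_trans : transitive tensor_eqv.
Proof.
move=> t s u /asboolP st /asboolP tu; apply/asboolP => V f fb.
by rewrite st // tu.
Qed.

Canonical tensor_equiv :=
  EquivRel tensor_eqv tensor_eqv_refl tensor_eqv_sym tensor_eqv_trans.

Definition tensor := {eq_quot tensor_equiv}.

HB.instance Definition _ := Choice.on tensor.
HB.instance Definition _ : EqQuotient _ tensor_eqv tensor :=
  EqQuotient.on tensor.

Lemma pi_tensorP s t :
  (forall (V : lmodType K) (f : X -> Y -> V), balanced f ->
    formal_eval f s = formal_eval f t) <-> \pi_tensor s = \pi_tensor t.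
Proof.
by split=> [st|/eqmodP /asboolP//]; apply/eqmodP/asboolP.
Qed.

Lemma repr_tensorP s (V : lmodType K) (f : X -> Y -> V) : balanced f ->
  formal_eval f (repr (\pi_tensor s)) = formal_eval f s.
Proof. by move=> fb; apply: (proj2 (pi_tensorP _ _)); rewrite ?reprK. Qed.

Lemma formal_eval_cat (V : lmodType K) (f : X -> Y -> V) s t :
  formal_eval f (s ++ t) = formal_eval f s + formal_eval f t.
Proof. exact: big_cat. Qed.

Definition formal_scale (c : K) (s : seq (X * Y)) : seq (X * Y) :=
  [seq (c *: p.1, p.2) | p <- s].

Lemma formal_eval_scale (V : lmodType K) (f : X -> Y -> V) c s : balanced f ->
  formal_eval f (formal_scale c s) = c *: formal_eval f s.
Proof.
case=> _ lf _; rewrite /formal_eval big_map scaler_sumr.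
apply: eq_bigr => p _ /=.
have f0 : f 0 p.2 = 0.
  by have /= := lf p.2 (-1) 0 0; rewrite scaler0 addr0 scaleN1r addNr.
by have /= := lf p.2 c p.1 0; rewrite !addr0 f0 addr0.
Qed.

Definition tensor_zero : tensor := \pi_tensor [::].
Definition tensor_add (u v : tensor) : tensor := \pi_tensor (repr u ++ repr v).
Definition tensor_scale (c : K) (u : tensor) : tensor :=
  \pi_tensor (formal_scale c (repr u)).
Definition tensor_opp (u : tensor) : tensor := tensor_scale (-1) u.

Let teq (u v : tensor) :
  (forall (V : lmodType K) (f : X -> Y -> V), balanced f ->
    formal_eval f (repr u) = formal_eval f (repr v)) -> u = v.
Proof. by move=> uv; rewrite -[u]reprK -[v]reprK; apply/pi_tensorP. Qed.

Let eval_add (V : lmodType K) (f : X -> Y -> V) u v : balanced f ->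
  formal_eval f (repr (tensor_add u v)) =
  formal_eval f (repr u) + formal_eval f (repr v).
Proof. by move=> fb; rewrite repr_tensorP // formal_eval_cat. Qed.

Let eval_zero (V : lmodType K) (f : X -> Y -> V) : balanced f ->
  formal_eval f (repr tensor_zero) = 0.
Proof. by move=> fb; rewrite repr_tensorP // /formal_eval big_nil. Qed.

Let eval_scale (V : lmodType K) (f : X -> Y -> V) c u : balanced f ->
  formal_eval f (repr (tensor_scale c u)) = c *: formal_eval f (repr u).
Proof. by move=> fb; rewrite repr_tensorP // formal_eval_scale. Qed.

Fact tensor_addA : associative tensor_add.
Proof. by move=> u v w; apply: teq => V f fb; rewrite !eval_add // addrA. Qed.

Fact tensor_addC : commutative tensor_add.
Proof. by move=> u v; apply: teq => V f fb; rewrite !eval_add // addrC. Qed.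

Fact tensor_add0 : left_id tensor_zero tensor_add.
Proof.
by move=> u; apply: teq => V f fb; rewrite eval_add // eval_zero // add0r.
Qed.

Fact tensor_addN : left_inverse tensor_zero tensor_opp tensor_add.
Proof.
move=> u; apply: teq => V f fb.
by rewrite eval_add // eval_scale // eval_zero // scaleN1r addNr.
Qed.

HB.instance Definition _ := GRing.isZmodule.Build tensor
  tensor_addA tensor_addC tensor_add0 tensor_addN.

Fact tensor_scalerA a b v :
  tensor_scale a (tensor_scale b v) = tensor_scale (a * b) v.
Proof. by apply: teq => V f fb; rewrite !eval_scale // scalerA. Qed.

Fact tensor_scale1r : left_id 1 tensor_scale.
Proof. by move=> v; apply: teq => V f fb; rewrite eval_scale // scale1r. Qed.

Fact tensor_scalerDr : right_distributive tensor_scale +%R.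
Proof.
move=> c u v; apply: teq => V f fb.
by rewrite eval_scale // !eval_add // !eval_scale // scalerDr.
Qed.

Fact tensor_scalerDl v : {morph tensor_scale^~ v : a b / a + b}.
Proof.
move=> a b; apply: teq => V f fb.
by rewrite eval_scale // eval_add // !eval_scale // scalerDl.
Qed.

HB.instance Definition _ := GRing.Zmodule_isLmodule.Build K tensor
  tensor_scalerA tensor_scale1r tensor_scalerDr tensor_scalerDl.

Definition pure (x : X) (y : Y) : tensor := \pi_tensor [:: (x, y)].

Definition tensor_lift (V : lmodType K) (f : X -> Y -> V) (u : tensor) : V :=
  formal_eval f (repr u).

Lemma pure_balanced : balanced pure.
Proof.
split=> [x c y y'|y c x x'|x a y]; apply: teq => V f fb.
- rewrite [RHS]eval_add // eval_scale // !repr_tensorP //.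
  by rewrite /formal_eval !big_seq1 /=; case: fb => + _ _; apply.
- rewrite [RHS]eval_add // eval_scale // !repr_tensorP //.
  rewrite /formal_eval !big_seq1 /=; case: fb => _ fl _.
  exact: (fl y).
- rewrite !repr_tensorP // /formal_eval !big_seq1 /=.
  by case: fb => _ _; apply.
Qed.

Lemma tensor_lift_linear (V : lmodType K) (f : X -> Y -> V) :
  balanced f -> linear (tensor_lift f).
Proof.
move=> fb c u v; rewrite /tensor_lift.
by rewrite [LHS]eval_add // eval_scale.
Qed.

Lemma tensor_lift_pure (V : lmodType K) (f : X -> Y -> V) x y :
  balanced f -> tensor_lift f (pure x y) = f x y.
Proof.
by move=> fb; rewrite /tensor_lift repr_tensorP // /formal_eval big_seq1.
Qed.

Lemma tensor_pi s : \pi_tensor s = \sum_(p <- s) pure p.1 p.2.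
Proof.
elim: s => [|[x y] s ih]; first by rewrite big_nil.
rewrite big_cons -ih; apply: teq => V f fb.
rewrite [RHS]eval_add // !repr_tensorP //.
by rewrite -formal_eval_cat.
Qed.

Lemma tensor_sum_pure (u : tensor) : u = \sum_(p <- repr u) pure p.1 p.2.
Proof. by rewrite -tensor_pi reprK. Qed.

Lemma tensor_eq_lin (V : lmodType K) (g h : {linear tensor -> V}) :
  (forall x y, g (pure x y) = h (pure x y)) -> g =1 h.
Proof.
move=> gh u; rewrite [u]tensor_sum_pure !linear_sum.
by apply: eq_bigr => p _; rewrite gh.
Qed.

End Tensor.

Definition spanning (K : nzRingType) (T : Type) (V : lmodType K)
    (f : T -> T -> V) : Prop :=
  forall v, exists s : seq (K * (T * T)),
    v = \sum_(t <- s) t.1 *: f t.2.1 t.2.2.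

Record right_inner_product (R : realDomainType) (B A : star_algebra R)
    (X : bimodule B A) (ip : X -> X -> A) : Prop := {
  rip_linear : forall x, linear (ip x);
  rip_herm : forall x y, ip x y = sa_star (ip y x);
  rip_ract : forall x y a, ip x (ract y a) = sa_mul (ip x y) a;
  rip_ge0 : forall x, positive_elt (ip x x);
  rip_lact : forall x y b, ip x (lact b y) = ip (lact (sa_star b) x) y;
  rip_full : spanning ip
}.

Record left_inner_product (R : realDomainType) (B A : star_algebra R)
    (X : bimodule B A) (ip : X -> X -> B) : Prop := {
  lip_linear : forall y, linear (ip^~ y);
  lip_herm : forall x y, ip x y = sa_star (ip y x);
  lip_lact : forall x y b, ip (lact b x) y = sa_mul b (ip x y);
  lip_ge0 : forall x, positive_elt (ip x x);
  lip_ract : forall x y a, ip (ract x a) y = ip x (ract y (sa_star a));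
  lip_full : spanning ip
}.

Section RieffelForm.
Variables (R : realDomainType) (B A : star_algebra R) (X : bimodule B A).
Variables (ip : X -> X -> A) (H : star_representation A).

(* The form on the tensor product of [X] and [H] over [A] extending
   [fun (x, psi) (y, phi) => ph_inner psi (rep (ip x y) phi)].  That it does
   not depend on the representatives, when [ip] satisfies the relevant axioms,
   is [rieffel_form_pure] together with [rieffel_form_linear] and
   [rieffel_form_herm]. *)
Definition rieffel_form (u v : tensor (@ract R B A X) (@rep R A H)) : cext R :=
  \sum_(p <- repr u) \sum_(q <- repr v)
    ph_inner p.2 (rep (ip p.1 q.1) q.2).

Hypothesis ip_linear : forall x, linear (ip x).
Hypothesis ip_herm : forall x y, ip x y = sa_star (ip y x).
Hypothesis ip_ract : forall x y a, ip x (ract y a) = sa_mul (ip x y) a.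

Let half (s : seq (X * H)) (y : X) (phi : H) : (cext R)^o :=
  \sum_(p <- s) ph_inner p.2 (rep (ip p.1 y) phi).

Let half_balanced s : balanced (@ract R B A X) (@rep R A H) (half s).
Proof.
split=> [y c phi phi'|phi c y y'|y a phi]; rewrite /half.
- rewrite scaler_sumr -big_split /=; apply: eq_bigr => p _.
  by rewrite rep_endo ph_linear.
- rewrite /= scaler_sumr -big_split /=; apply: eq_bigr => p _.
  by rewrite ip_linear (rep_linear phi) ph_linear.
- by apply: eq_bigr => p _; rewrite ip_ract rep_mul.
Qed.

Let rieffel_formE u v :
  rieffel_form u v = tensor_lift (half (repr u)) v.
Proof. exact: exchange_big. Qed.

Lemma rieffel_form_linear u : scalar (rieffel_form u).
Proof.
move=> c v w; rewrite !rieffel_formE.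
exact: (tensor_lift_linear (half_balanced _)).
Qed.

Lemma rieffel_form_herm u v : rieffel_form u v = cconj (rieffel_form v u).
Proof.
rewrite /rieffel_form exchange_big rmorph_sum; apply: eq_bigr => q _.
rewrite rmorph_sum; apply: eq_bigr => p _.
by rewrite ph_herm rep_star -ip_herm.
Qed.

Lemma rieffel_form_pure x psi y phi :
  rieffel_form (pure _ _ x psi) (pure _ _ y phi) =
  ph_inner psi (rep (ip x y) phi).
Proof.
rewrite rieffel_formE (tensor_lift_pure _ _ (half_balanced _)) /half.
under eq_bigr do rewrite ph_herm rep_star -ip_herm.
rewrite -rmorph_sum.
have -> : \sum_(p <- repr (pure (@ract R B A X) (@rep R A H) x psi))
            ph_inner phi (rep (ip y p.1) p.2) =
          tensor_lift (half [:: (y, phi)])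
            (pure (@ract R B A X) (@rep R A H) x psi).
  by apply: eq_bigr => p _; rewrite /half big_seq1.
rewrite (tensor_lift_pure _ _ (half_balanced _)) /half big_seq1 /=.
by rewrite [RHS]ph_herm rep_star -ip_herm.
Qed.

End RieffelForm.

Definition condition_P (R : realDomainType) (B A : star_algebra R)
    (X : bimodule B A) (ip : X -> X -> A) : Prop :=
  forall (H : star_representation A)
    (u : tensor (@ract R B A X) (@rep R A H)),
    cge0 (rieffel_form ip u u).

Record equivalence_bimodule (R : realDomainType) (B A : star_algebra R) :=
    EquivalenceBimodule {
  eb_bimodule :> bimodule B A;
  ipr : eb_bimodule -> eb_bimodule -> A;
  ipl : eb_bimodule -> eb_bimodule -> B;
  eb_right : right_inner_product ipr;
  eb_left : left_inner_product ipl;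
  eb_compat : forall x y z, lact (ipl x y) z = ract x (ipr y z);
  eb_P : condition_P ipr;
  eb_Q : condition_P (X := conj_bimodule eb_bimodule) ipl
}.

Definition formally_Morita_equivalent (R : realDomainType)
    (A B : star_algebra R) : Prop :=
  inhabited (equivalence_bimodule B A).

Definition submodule (K : nzRingType) (V : lmodType K) (S : set V) : Prop :=
  S 0 /\ forall c u v, S u -> S v -> S (c *: u + v).

Definition direct_sum (K : nzRingType) (V : lmodType K) (I : choiceType)
    (S : I -> set V) : Prop :=
  (forall i, submodule (S i)) /\
  forall x, exists! c : I -> V,
    [/\ finite_set [set i | c i <> 0], forall i, S i (c i)
      & x = \sum_(i \in [set: I]) c i].

Definition directed_set (J : Type) (le : J -> J -> Prop) : Prop :=
  [/\ inhabited J, forall a, le a a,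
      forall a b c, le a b -> le b c -> le a c
    & forall a b, exists c, le a c /\ le b c].

(* [act x a] is [x . a] for a right action and [a . x] for a left action.
   The members [T al] of the directed unions are only required to be
   submodules over the scalars, not to be stable under [act]. *)
Definition pseudo_cyclic_decomposition (K : nzRingType) (X A : lmodType K)
    (act : X -> A -> X) (ip : X -> X -> A) : Prop :=
  exists (I : choiceType) (S : I -> set X),
    [/\ direct_sum S,
        forall i j, i <> j -> forall x y, S i x -> S j y -> ip x y = 0,
        forall i x a, S i x -> S i (act x a)
      & forall i, exists (J : Type) (le : J -> J -> Prop)
          (T : J -> set X) (omega : J -> X),
          [/\ directed_set le,
              forall al, submodule (T al),
              forall al be, le al be -> T al `<=` T be,
              S i = \bigcup_al T al
            & forall al, T al (omega al) /\
                forall x, T al x -> exists a, x = act (omega al) a]].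

Definition conditions_P1_P3 (R : realDomainType) (B A : star_algebra R)
    (X : equivalence_bimodule B A) : Prop :=
  pseudo_cyclic_decomposition (@ract R B A X) (@ipr R B A X).

Definition conditions_Q1_Q3 (R : realDomainType) (B A : star_algebra R)
    (X : equivalence_bimodule B A) : Prop :=
  pseudo_cyclic_decomposition (fun x b => lact b x) (@ipl R B A X).

(* Main.v *)
Require Import Defs.
From HB Require Import structures.
From mathcomp Require Import all_boot all_order all_algebra generic_quotient.
From mathcomp Require Import complex ring.
From mathcomp Require Import boolp classical_sets fsbigop.

(* The bimodule is the conjugate of [X (x)_A X'], presented as
   [conj X' (x)_A conj X], with inner products
   [<x (x) x', y (x) y'>_D = <x', <x, y>_A y'>_D] and symmetrically for [B].
   By P1--P3 every tensor is a sum of [x_i (x) y_i] with pairwise orthogonal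
   [x_i], which reduces positivity of [<u, u>_D] to that of the diagonal terms
   [<y_i, <x_i, x_i>_A y_i>_D]; by Q1--Q3 one has [X' = A X'], which gives
   fullness although the algebras need not be unital.  The [B]-valued side is
   the same argument with the conjugate bimodules exchanged.  Condition P
   follows by inducing representations in stages. *)

Set Implicit Arguments.
Unset Strict Implicit.
Unset Printing Implicit Defensive.

Import Order.TTheory GRing.Theory Num.Theory.

Local Open Scope classical_set_scope.
Local Open Scope ring_scope.
Local Open Scope quotient_scope.

(** * Positivity in [cext R] *)

Section ComplexPositivity.
Variable R : realDomainType.
Implicit Types z : cext R.

Lemma cge0_0 : cge0 (0 : cext R).
Proof. by rewrite /cge0 /= eqxx lexx. Qed.

Lemma cge0D z z' : cge0 z -> cge0 z' -> cge0 (z + z').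
Proof.
case: z z' => [a b] [c d] /andP[/= /eqP -> a0] /andP[/= /eqP -> c0].
by rewrite /cge0 /= addr0 eqxx addr_ge0.
Qed.


(** Since [q + 2] is strictly positive, the square of [a ^+ 2 + b ^+ 2] must be nonpositive, so both
    parts of [z] vanish. The expression is the value of a semidefinite form at the test vector of
    [sf_null]. *)
Lemma cge0_sqr_norm_eq0 q z :
  cge0 q -> cge0 (- ((z * cconj z) ^+ 2 * (q + 1 + 1))) -> z = 0.
Proof.
case: q z => [q q'] [a b] /andP[/= /eqP -> q0] /andP[_].
rewrite [X in 0 <= X](_ : _ =
    - ((a ^+ 2 + b ^+ 2) ^+ 2 * (q + 2%:R))); last first.
  rewrite expr2 /=. 
  by ring.
rewrite oppr_ge0 pmulr_lle0; last by rewrite ltr_wpDl.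
move=> n0; have : (a ^+ 2 + b ^+ 2) ^+ 2 == 0 by rewrite eq_le n0 sqr_ge0.
rewrite expf_eq0 /= paddr_eq0 ?sqr_ge0 // !expf_eq0 /=.
by case/andP=> /eqP -> /eqP ->.
Qed.

End ComplexPositivity.

(** * Semidefinite forms and the quotient by their null vectors *)

Record semidefinite_form (R : realDomainType) (V : lmodType (cext R)) :=
    SemidefiniteForm {
  sf :> V -> V -> cext R;
  sf_linear : forall u, scalar (sf u);
  sf_herm : forall u v, sf u v = cconj (sf v u);
  sf_ge0 : forall u, cge0 (sf u u)
}.

Section SemidefiniteQuotient.
Variables (R : realDomainType) (V : lmodType (cext R)).
Variable f : semidefinite_form V.

Lemma sfDr u v w : f u (v + w) = f u v + f u w.
Proof. by have := sf_linear f u 1 v w; rewrite scale1r mul1r. Qed.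

Lemma sf0r u : f u 0 = 0.
Proof. by apply: (addrI (f u 0)); rewrite -sfDr !addr0. Qed.

Lemma sfZr u c v : f u (c *: v) = c * f u v.
Proof. by have := sf_linear f u c v 0; rewrite sf0r !addr0. Qed.

Lemma sfDl u v w : f (v + w) u = f v u + f w u.
Proof. by rewrite sf_herm sfDr rmorphD /= -!sf_herm. Qed.

Lemma sfZl u c v : f (c *: v) u = cconj c * f v u.
Proof. by rewrite sf_herm sfZr rmorphM /= -sf_herm. Qed.

(** A division-free Cauchy-Schwarz argument. With [z = f w u], [n = z * cconj z] and [q = f w w],
    the form takes the value [- n ^+ 2 * (q + 2)] at the vector [n w - (q + 1) (cconj z) u]. The
    summand 1 in [q + 1] also covers the case [q = 0]. *)
Lemma sf_null u w : f u u = 0 -> f w u = 0.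
Proof.
move=> u0; have q0 := sf_ge0 f w.
(* The existentials make [z] and [n] opaque, so that [rewrite] and [ring] treat them as atoms. *)
have [z zE] : exists z, z = f w u by exists (f w u).
have [n nE] : exists n, n = z * cconj z by exists (z * cconj z).
have nc : cconj n = n by rewrite nE rmorphM /= cconjK mulrC.
have qc : cconj (f w w) = f w w by rewrite -sf_herm.
have := sf_ge0 f (n *: w + (- ((f w w + 1) * cconj z)) *: u).
rewrite !sfDr !sfZr !sfDl !sfZl u0 nc (sf_herm f u w) -zE.
rewrite rmorphN rmorphM rmorphD rmorph1 /= cconjK qc.
rewrite [X in cge0 X](_ : _ = - ((z * cconj z) ^+ 2 * (f w w + 1 + 1))).
  by move/(cge0_sqr_norm_eq0 q0).
by rewrite nE; ring.
Qed.

(** Testing against all vectors makes this visibly a congruence; by [sf_null] its null class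
    consists of the vectors with [f u u = 0], so the induced form is definite. *)
Definition sf_eqv (u v : V) : bool := `[< forall w, f w u = f w v >].

Fact sf_eqv_refl : reflexive sf_eqv.
Proof. by move=> u; apply/asboolP. Qed.

Fact sf_eqv_sym : symmetric sf_eqv.
Proof. by move=> u v; apply/asboolP/asboolP => uv w; rewrite uv. Qed.

Fact sf_eqv_trans : transitive sf_eqv.
Proof.
by move=> v u w /asboolP uv /asboolP vw; apply/asboolP => t; rewrite uv vw.
Qed.

Canonical sf_equiv := EquivRel sf_eqv sf_eqv_refl sf_eqv_sym sf_eqv_trans.

Definition sf_quot := {eq_quot sf_equiv}.

HB.instance Definition _ := Choice.on sf_quot.
HB.instance Definition _ : EqQuotient _ sf_eqv sf_quot :=
  EqQuotient.on sf_quot.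

Local Notation p := (\pi_sf_quot).

Lemma pi_sf_quotP u v : (forall w, f w u = f w v) <-> p u = p v.
Proof. by split=> [uv|/eqmodP/asboolP//]; apply/eqmodP/asboolP. Qed.

Lemma sf_repr w u : f w (repr (p u)) = f w u.
Proof. by apply: (proj2 (pi_sf_quotP _ _)); rewrite reprK. Qed.

Definition quot_add (a b : sf_quot) : sf_quot := p (repr a + repr b).
Definition quot_opp (a : sf_quot) : sf_quot := p (- repr a).
Definition quot_scale c (a : sf_quot) : sf_quot := p (c *: repr a).

Let quot_eq (a b : sf_quot) : (forall w, f w (repr a) = f w (repr b)) -> a = b.
Proof. by move=> ab; rewrite -[a]reprK -[b]reprK; apply/pi_sf_quotP. Qed.

Lemma sfNr u v : f u (- v) = - f u v.
Proof. by rewrite -scaleN1r sfZr mulN1r. Qed.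

Fact quot_addA : associative quot_add.
Proof.
by move=> a b c; apply: quot_eq => w; rewrite !(sf_repr, sfDr) addrA.
Qed.

Fact quot_addC : commutative quot_add.
Proof. by move=> a b; apply: quot_eq => w; rewrite !sf_repr !sfDr addrC. Qed.

Fact quot_add0 : left_id (p 0) quot_add.
Proof.
by move=> a; apply: quot_eq => w; rewrite !(sf_repr, sfDr) sf0r add0r.
Qed.

Fact quot_addN : left_inverse (p 0) quot_opp quot_add.
Proof.
by move=> a; apply: quot_eq => w; rewrite !(sf_repr, sfDr, sfNr) sf0r addNr.
Qed.

HB.instance Definition _ := GRing.isZmodule.Build sf_quot
  quot_addA quot_addC quot_add0 quot_addN.

Fact quot_scalerA a b v :
  quot_scale a (quot_scale b v) = quot_scale (a * b) v.
Proof. by apply: quot_eq => w; rewrite !(sf_repr, sfZr) mulrA. Qed.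

Fact quot_scale1r : left_id 1 quot_scale.
Proof. by move=> v; apply: quot_eq => w; rewrite !(sf_repr, sfZr) mul1r. Qed.

Fact quot_scalerDr : right_distributive quot_scale +%R.
Proof.
by move=> c u v; apply: quot_eq => w; rewrite !(sf_repr, sfZr, sfDr) mulrDr.
Qed.

Fact quot_scalerDl v : {morph quot_scale^~ v : a b / a + b}.
Proof.
by move=> a b; apply: quot_eq => w; rewrite !(sf_repr, sfZr, sfDr) mulrDl.
Qed.

HB.instance Definition _ := GRing.Zmodule_isLmodule.Build (cext R) sf_quot
  quot_scalerA quot_scale1r quot_scalerDr quot_scalerDl.

Definition quot_inner (a b : sf_quot) : cext R := f (repr a) (repr b).

Lemma quot_inner_pi u v : quot_inner (p u) (p v) = f u v.
Proof. by rewrite /quot_inner sf_repr sf_herm sf_repr -sf_herm. Qed.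

Fact quot_inner_linear a : scalar (quot_inner a).
Proof. by move=> c u v; rewrite /quot_inner !(sf_repr, sfZr, sfDr). Qed.

Fact quot_inner_eq0 a : quot_inner a a = 0 -> a = 0.
Proof.
by move=> a0; apply: quot_eq => w; rewrite sf_null // sf_repr sf0r.
Qed.

Definition quot_prehilbert : prehilbert R :=
  @PreHilbert R sf_quot quot_inner quot_inner_linear
    (fun a b => sf_herm f _ _) (fun a => sf_ge0 f _) quot_inner_eq0.

End SemidefiniteQuotient.

(* A *-representation on a space with a semidefinite form descends to the
   quotient by the null vectors, since adjointability makes it preserve them. *)
Section QuotientRepresentation.
Variables (R : realDomainType) (A : star_algebra R) (V : lmodType (cext R)).
Variables (f : semidefinite_form V) (act : A -> V -> V).
Hypothesis act_endo : forall a, linear (act a).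
Hypothesis act_linear : forall v, linear (act^~ v).
Hypothesis act_mul : forall a b v, act (sa_mul a b) v = act a (act b v).
Hypothesis act_star : forall a u v, f (act a u) v = f u (act (sa_star a) v).

Local Notation p := (\pi_(sf_quot f)).
Definition quot_act (a : A) (u : quot_prehilbert f) : quot_prehilbert f :=
  p (act a (repr u)).

Lemma quot_act_pi a v : quot_act a (p v) = p (act a v).
Proof.
apply: (proj1 (@pi_sf_quotP R V f _ _)) => w.
by rewrite -[a]sa_starK -!act_star sf_repr.
Qed.

Lemma piD u v : p (u + v) = p u + p v.
Proof. by apply/pi_sf_quotP => w; rewrite !(sf_repr, sfDr). Qed.

Lemma piZ c u : p (c *: u) = c *: p u.
Proof. by apply/pi_sf_quotP => w; rewrite !(sf_repr, sfZr). Qed.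

Fact quot_act_endo a : linear (quot_act a).
Proof.
move=> c u v; rewrite -[u]reprK -[v]reprK -piZ -piD !quot_act_pi.
by rewrite act_endo piD piZ.
Qed.

Fact quot_act_linear u : linear (quot_act^~ u).
Proof.
by move=> c a b; rewrite -[u]reprK !quot_act_pi act_linear piD piZ.
Qed.

Fact quot_act_mul a b u : quot_act (sa_mul a b) u = quot_act a (quot_act b u).
Proof. by rewrite -[u]reprK (quot_act_pi b) !quot_act_pi act_mul. Qed.

Fact quot_act_star a :
  @adjoint_of R (quot_prehilbert f) (quot_act a) (quot_act (sa_star a)).
Proof.
move=> u v; rewrite -[u]reprK -[v]reprK !quot_act_pi.
by rewrite [LHS]quot_inner_pi [RHS]quot_inner_pi act_star.
Qed.

Definition quot_representation : star_representation A :=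
  @StarRepresentation R A (quot_prehilbert f) quot_act quot_act_endo
    quot_act_linear quot_act_mul quot_act_star.

End QuotientRepresentation.

(** * Additive and linear maps *)

Section AdditiveMaps.

Lemma morphD_sum (V W : zmodType) (g : V -> W) (J : Type) (s : seq J)
    (F : J -> V) :
  {morph g : x y / x + y} -> g (\sum_(j <- s) F j) = \sum_(j <- s) g (F j).
Proof.
move=> gD; have g0 : g 0 = 0 by apply: (addrI (g 0)); rewrite -gD !addr0.
exact: (big_morph g gD g0).
Qed.

Lemma linear_morphD (K : nzRingType) (V W : lmodType K) (g : V -> W) :
  linear g -> {morph g : x y / x + y}.
Proof. by move=> gl x y; have := gl 1 x y; rewrite !scale1r. Qed.

Lemma linear_morph0 (K : nzRingType) (V W : lmodType K) (g : V -> W) :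
  linear g -> g 0 = 0.
Proof. by move=> gl; have := gl (-1) 0 0; rewrite !scaleN1r !addNr. Qed.

Lemma linear_morphZ (K : nzRingType) (V W : lmodType K) (g : V -> W) c x :
  linear g -> g (c *: x) = c *: g x.
Proof. by move=> gl; have := gl c x 0; rewrite (linear_morph0 gl) !addr0. Qed.

End AdditiveMaps.

(** * Induction on tensors, and endomorphisms of a tensor product *)

Section TensorInduction.
Variables (K : comNzRingType) (A : Type) (X Y : lmodType K).
Variables (r : X -> A -> X) (l : A -> Y -> Y).

Lemma tensor_ind (P : tensor r l -> Prop) :
  P 0 -> (forall u v, P u -> P v -> P (u + v)) ->
  (forall x y, P (pure r l x y)) -> forall u, P u.
Proof. by move=> P0 PD Pp u; rewrite [u]tensor_sum_pure; apply: big_ind. Qed.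

(** Every tensor is a plain sum of pure ones, so additivity suffices. This matters because inner
    products are conjugate linear in one argument. *)
Lemma tensor_eq_morphD (V : zmodType) (g h : tensor r l -> V) :
  {morph g : u v / u + v} -> {morph h : u v / u + v} ->
  (forall x y, g (pure r l x y) = h (pure r l x y)) -> g =1 h.
Proof.
move=> gD hD gh u; rewrite [u]tensor_sum_pure !morphD_sum //.
by apply: eq_bigr => p _; rewrite gh.
Qed.

Lemma pureDr x : {morph pure r l x : y y' / y + y'}.
Proof. by apply: linear_morphD; case: (pure_balanced r l) => + _ _. Qed.

Lemma pureDl y : {morph (pure r l)^~ y : x x' / x + x'}.
Proof. by apply: linear_morphD; case: (pure_balanced r l) => _ + _. Qed.

Lemma pure_act x a y : pure r l (r x a) y = pure r l x (l a y).
Proof. by case: (pure_balanced r l). Qed.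

Variables (g : X -> X) (h : Y -> Y).
Hypotheses (g_linear : linear g) (h_linear : linear h).
Hypotheses (gr : forall x a, g (r x a) = r (g x) a).
Hypotheses (hl : forall a y, h (l a y) = l a (h y)).

Definition tensor_map : tensor r l -> tensor r l :=
  tensor_lift (fun x y => pure r l (g x) (h y)).

Lemma tensor_map_balanced : balanced r l (fun x y => pure r l (g x) (h y)).
Proof.
case: (pure_balanced r l) => pr pl pb; split=> [x c y y'|y c x x'|x a y].
- by rewrite h_linear pr.
- by rewrite g_linear pl.
- by rewrite gr pb hl.
Qed.

Lemma tensor_map_linear : linear tensor_map.
Proof. exact/tensor_lift_linear/tensor_map_balanced. Qed.

Lemma tensor_map_pure x y :
  tensor_map (pure r l x y) = pure r l (g x) (h y).
Proof. exact/tensor_lift_pure/tensor_map_balanced. Qed.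

End TensorInduction.

(* Both the [D]-valued and, with values in a conjugate module, the conjugate
   linear forms on a tensor product arise this way. *)
Section TensorForm.
Variables (K : comNzRingType) (A : Type) (X Y V : lmodType K).
Variables (r : X -> A -> X) (l : A -> Y -> Y) (star : V -> V).
Variable k : X -> Y -> X -> Y -> V.
Hypothesis starD : {morph star : a b / a + b}.
Hypothesis k_balanced : forall x y, balanced r l (k x y).
Hypothesis k_herm : forall x y x' y', k x y x' y' = star (k x' y' x y).

Definition tensor_form (u v : tensor r l) : V :=
  \sum_(p <- repr u) \sum_(q <- repr v) k p.1 p.2 q.1 q.2.

Let half (s : seq (X * Y)) (x : X) (y : Y) : V :=
  \sum_(p <- s) k p.1 p.2 x y.

Let half_balanced s : balanced r l (half s).
Proof.
split=> [x c y y'|y c x x'|x a y]; rewrite /half.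
- rewrite scaler_sumr -big_split; apply: eq_bigr => p _.
  by case: (k_balanced p.1 p.2) => + _ _; apply.
- rewrite scaler_sumr -big_split; apply: eq_bigr => p _.
  by case: (k_balanced p.1 p.2) => _ + _; apply.
- by apply: eq_bigr => p _; case: (k_balanced p.1 p.2).
Qed.

Let tensor_formE u v : tensor_form u v = tensor_lift (half (repr u)) v.
Proof. exact: exchange_big. Qed.

Lemma tensor_form_linear u : linear (tensor_form u).
Proof.
move=> c v w; rewrite !tensor_formE.
exact: (tensor_lift_linear (half_balanced _)).
Qed.

Lemma tensor_form_herm u v : tensor_form u v = star (tensor_form v u).
Proof.
rewrite /tensor_form exchange_big morphD_sum //; apply: eq_bigr => q _.
by rewrite morphD_sum //; apply: eq_bigr => p _; rewrite -k_herm.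
Qed.

(** Balancedness of [k] removes the chosen representative of the second argument. Hermitian symmetry
    then turns the sum over the representative of the first argument into one of the same kind. *)
Lemma tensor_form_pure x y x' y' :
  tensor_form (pure r l x y) (pure r l x' y') = k x y x' y'.
Proof.
rewrite tensor_formE tensor_lift_pure // /half.
under eq_bigr do rewrite k_herm.
rewrite -(morphD_sum _ _ starD) [RHS]k_herm; congr star.
by apply: (@tensor_lift_pure _ _ _ _ r l _ (k x' y')).
Qed.

End TensorForm.

(** * The tensor product of two bimodules *)

Section TensorBimodule.
Variables (R : realDomainType) (B A D : star_algebra R).
Variables (X : bimodule B A) (X' : bimodule A D).
Local Notation T := (tensor (@ract R B A X) (@lact R A D X')).
Local Notation p := (pure (@ract R B A X) (@lact R A D X')).

Definition tensor_lact (b : B) : T -> T := tensor_map (lact b) id.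
Definition tensor_ract (u : T) (d : D) : T :=
  tensor_map id (fun y => ract y d) u.

Fact tensor_lact_linear b : linear (tensor_lact b).
Proof.
apply: tensor_map_linear; [exact: (@lact_linear R B A X b)|by []| |by []].
by move=> x a; rewrite lract_comm.
Qed.

Fact tensor_ract_linear d : linear (tensor_ract^~ d).
Proof.
apply: tensor_map_linear; [by []|exact: (@ract_linear R A D X' d)|by []|].
by move=> a y; rewrite lract_comm.
Qed.

Lemma tensor_lact_pure b x y : tensor_lact b (p x y) = p (lact b x) y.
Proof.
apply: tensor_map_pure; [exact: (@lact_linear R B A X b)|by []| |by []].
by move=> x' a; rewrite lract_comm.
Qed.

Lemma tensor_ract_pure d x y : tensor_ract (p x y) d = p x (ract y d).
Proof.
apply: (@tensor_map_pure _ _ _ _ _ _ id (fun y => ract y d));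
  [by []|exact: (@ract_linear R A D X' d)|by []|].
by move=> a y'; rewrite lract_comm.
Qed.

Let lactD b := linear_morphD (tensor_lact_linear b).
Let ractD d := linear_morphD (tensor_ract_linear d).

Fact tensor_lact_linearl u : linear (tensor_lact^~ u).
Proof.
move=> c b b'; elim/tensor_ind: u => [|u v|x y].
- by rewrite !(linear_morph0 (tensor_lact_linear _)) scaler0 addr0.
- by rewrite !lactD => -> ->; rewrite scalerDr addrACA.
- rewrite !tensor_lact_pure lact_linearl.
  by case: (pure_balanced (@ract R B A X) (@lact R A D X')) => _ -> _.
Qed.

Fact tensor_ract_linearr u : linear (tensor_ract u).
Proof.
move=> c d d'; elim/tensor_ind: u => [|u v|x y].
- by rewrite !(linear_morph0 (tensor_ract_linear _)) scaler0 addr0.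
- by rewrite !ractD => -> ->; rewrite scalerDr addrACA.
- rewrite !tensor_ract_pure ract_linearr.
  by case: (pure_balanced (@ract R B A X) (@lact R A D X')) => -> _ _.
Qed.

Fact tensor_lact_mul b b' u :
  tensor_lact (sa_mul b b') u = tensor_lact b (tensor_lact b' u).
Proof.
elim/tensor_ind: u => [|u v|x y].
- by rewrite !(linear_morph0 (tensor_lact_linear _)).
- by rewrite !lactD => -> ->.
- by rewrite !tensor_lact_pure lact_mul.
Qed.

Fact tensor_ract_mul u d d' :
  tensor_ract u (sa_mul d d') = tensor_ract (tensor_ract u d) d'.
Proof.
elim/tensor_ind: u => [|u v|x y].
- by rewrite !(linear_morph0 (tensor_ract_linear _)).
- by rewrite !ractD => -> ->.
- by rewrite !tensor_ract_pure ract_mul.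
Qed.

Fact tensor_lract_comm b u d :
  tensor_ract (tensor_lact b u) d = tensor_lact b (tensor_ract u d).
Proof.
elim/tensor_ind: u => [|u v|x y].
- by rewrite !(linear_morph0 (tensor_ract_linear _),
               linear_morph0 (tensor_lact_linear _)).
- by rewrite !(ractD, lactD) => -> ->.
- by rewrite !(tensor_ract_pure, tensor_lact_pure).
Qed.

Definition tensor_bimodule : bimodule B D :=
  @Bimodule R B D T tensor_lact tensor_ract tensor_lact_linear
    tensor_lact_linearl tensor_lact_mul tensor_ract_linear tensor_ract_linearr
    tensor_ract_mul tensor_lract_comm.

End TensorBimodule.

(** * Positive elements and algebra-valued inner products *)

Section StarAlgebraTheory.
Variables (R : realDomainType) (A : star_algebra R).
Implicit Types a b : A.

Lemma starD : {morph @sa_star R A : a b / a + b}.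
Proof.
by move=> a b; have := sa_star_antilinear 1 a b; rewrite rmorph1 !scale1r.
Qed.

Lemma starZ c a : sa_star (c *: a) = cconj c *: sa_star a.
Proof.
have star0 : sa_star (0 : A) = 0.
  by apply: (addrI (sa_star 0)); rewrite -starD !addr0.
by have := sa_star_antilinear c a 0; rewrite star0 !addr0.
Qed.

Lemma positive_elt_sum (J : Type) (s : seq J) (F : J -> A) :
  (forall j, positive_elt (F j)) -> positive_elt (\sum_(j <- s) F j).
Proof.
move=> Fp; split=> [|w wp].
  by rewrite (morphD_sum _ _ starD); apply: eq_bigr => j _; case: (Fp j).
rewrite linear_sum; elim/big_ind: _ => [||j _].
- exact: cge0_0.
- exact: cge0D.
- by case: (Fp j) => _; apply.
Qed.

End StarAlgebraTheory.

Section RightInnerProductTheory.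
Variables (R : realDomainType) (B A : star_algebra R) (X : bimodule B A).
Variable ip : X -> X -> A.
Hypothesis ipP : right_inner_product ip.

Lemma ripDr x : {morph ip x : y z / y + z}.
Proof. exact: (linear_morphD (rip_linear ipP x)). Qed.

Lemma ripDl y : {morph ip^~ y : x z / x + z}.
Proof.
move=> x z.
by rewrite /= (rip_herm ipP) ripDr starD -!(rip_herm ipP).
Qed.

Lemma ripZr c x y : ip x (c *: y) = c *: ip x y.
Proof. exact: (linear_morphZ c y (rip_linear ipP x)). Qed.

(* For a positive functional [w], [b |-> w (ip y (b y))] is positive. *)
Lemma positive_elt_rip_lact (y : X) (b : B) :
  positive_elt b -> positive_elt (ip y (lact b y)).
Proof.
move=> [bh bp]; split=> [|w wp].
  by rewrite -(rip_herm ipP) (rip_lact ipP) bh.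
pose g : B -> cext R := fun c => w (ip y (lact c y)).
have gl : scalar g.
  by move=> c d e; rewrite /g (lact_linearl y) ripDr ripZr linearP.
pose gL : {scalar B} := HB.pack g (GRing.isLinear.Build _ _ _ _ g gl).
(* Here [<y, c^* c y> = <c y, c y>], on which [w] is nonnegative by [rip_ge0]. *)
apply: (bp gL) => c; rewrite /= /g lact_mul (rip_lact ipP) sa_starK.
by case: (rip_ge0 ipP (lact c y)) => _; apply.
Qed.

End RightInnerProductTheory.

(** Lets the product construction be carried out for right inner products only: the left-handed
    statements come from conjugate bimodules, where both actions are twisted by the involution and
    scalars by [cconj]. *)
Lemma conj_inner_productP (R : realDomainType) (B A : star_algebra R)
    (X : bimodule B A) (ip : X -> X -> B) :
  right_inner_product (X := conj_bimodule X) ip <-> left_inner_product ip.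
Proof.
split=> ipP.
- split.
  + move=> y c u v /=; rewrite (rip_herm ipP).
    have := rip_linear ipP y (cconj c) u v.
    rewrite /GRing.scale /= /conj_scale cconjK => ->.
    by rewrite starD starZ cconjK -!(rip_herm ipP).
  + exact: rip_herm ipP.
  + move=> x y b; have := rip_ract ipP y x (sa_star b).
    rewrite /= /conj_ract sa_starK (rip_herm ipP) => /(congr1 (@sa_star _ _)).
    by rewrite sa_starK sa_starM sa_starK -(rip_herm ipP).
  + exact: rip_ge0 ipP.
  + move=> x y a; have := rip_lact ipP x y a.
    by rewrite /= /conj_lact sa_starK => ->.
  + exact: rip_full ipP.
- split.
  + move=> x c u v /=; rewrite (lip_herm ipP).
    rewrite [c *: u]/(cconj c *: (u : X)).
    rewrite (lip_linear ipP x (cconj c) u v).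
    by rewrite starD starZ cconjK -!(lip_herm ipP).
  + exact: lip_herm ipP.
  + move=> x y b; rewrite /= /conj_ract (lip_herm ipP) (lip_lact ipP).
    by rewrite sa_starM sa_starK -(lip_herm ipP).
  + exact: lip_ge0 ipP.
  + move=> x y a; rewrite /= /conj_lact sa_starK.
    by rewrite (lip_ract ipP).
  + exact: lip_full ipP.
Qed.

(** * Orthogonal decompositions with locally cyclic pieces *)

(** The working form of the decomposition. The common vector [z] in the last clause is what allows
    two terms of a tensor whose first factors lie in the same piece to be merged into one. *)
Definition orthogonal_cyclic_family (X A : zmodType) (act : X -> A -> X)
    (ip : X -> X -> A) : Prop :=
  exists (I : eqType) (S : I -> set X),
    [/\ forall i, S i 0,
        forall x, exists s : seq (I * X),
          (forall p, p \in s -> S p.1 p.2) /\ x = \sum_(p <- s) p.2,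
        forall i j, i <> j -> forall x y, S i x -> S j y -> ip x y = 0
      & forall i x y, S i x -> S i y ->
          exists z a b, [/\ S i z, x = act z a & y = act z b]].

(** By directedness two vectors of one summand lie in a common [T ga], hence both are multiples of
    [om ga]. *)
Lemma pseudo_cyclic_family (K : nzRingType) (X A : lmodType K)
    (act : X -> A -> X) (ip : X -> X -> A) :
  pseudo_cyclic_decomposition act ip -> orthogonal_cyclic_family act ip.
Proof.
move=> [I [S [[Ssub Sdec] Sorth _ Scyc]]]; exists I, S; split=> //.
- by move=> i; case: (Ssub i).
- move=> x; have [c [[cfin Sc ->] _]] := Sdec x.
  exists [seq (i, c i) | i <- finite_support 0 [set: I] c]; split.
    by move=> p /mapP[i _ ->].
  by rewrite big_map.
- move=> i x y.
  have [J [le [T [om [[_ _ _ ledir] _ Tmono -> Tcyc]]]]] := Scyc i.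
  move=> [al _ Tx] [be _ Ty]; have [ga [alga bega]] := ledir al be.
  have [Tom Tact] := Tcyc ga.
  have [a xE] := Tact x (Tmono _ _ alga _ Tx).
  have [b yE] := Tact y (Tmono _ _ bega _ Ty).
  by exists (om ga), a, b; split=> //; exists ga.
Qed.

(** * The product of two inner products *)

Section ProductOfInnerProducts.
Variables (R : realDomainType) (B A D : star_algebra R).
Variables (X : bimodule B A) (X' : bimodule A D) (Z : bimodule B D).
Variables (ip : X -> X -> A) (ip' : X' -> X' -> D) (F : Z -> Z -> D).
(** [Z] and [tau] stay abstract because two models occur: the tensor product itself, and the
    conjugate of the tensor product of the conjugate bimodules in reverse order. *)
Variable tau : X -> X' -> Z.
Hypotheses (ipP : right_inner_product ip) (ip'P : right_inner_product ip').
Hypothesis tauDl : forall y, {morph tau^~ y : x x' / x + x'}.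
Hypothesis tauDr : forall x, {morph tau x : y y' / y + y'}.
Hypothesis tau_ract : forall x a y, tau (ract x a) y = tau x (lact a y).
Hypothesis lact_tau : forall b x y, lact b (tau x y) = tau (lact b x) y.
Hypothesis ract_tau : forall x y d, ract (tau x y) d = tau x (ract y d).
Hypothesis tau_span :
  forall z, exists s : seq (X * X'), z = \sum_(p <- s) tau p.1 p.2.
Hypothesis F_linear : forall z, linear (F z).
Hypothesis F_herm : forall z w, F z w = sa_star (F w z).
Hypothesis F_tau : forall x y x' y',
  F (tau x y) (tau x' y') = ip' y (lact (ip x x') y').

Let FDr z : {morph F z : u v / u + v}.
Proof. exact: (linear_morphD (F_linear z)). Qed.

Let FDl z : {morph F^~ z : u v / u + v}.
Proof. by move=> u v; rewrite /= F_herm FDr starD -!F_herm. Qed.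

Let F0l w : F 0 w = 0.
Proof. by apply: (addrI (F 0 w)); rewrite -FDl !addr0. Qed.

Let tau_ind (P : Z -> Prop) :
  P 0 -> (forall u v, P u -> P v -> P (u + v)) ->
  (forall x y, P (tau x y)) -> forall z, P z.
Proof. by move=> P0 PD Pt z; have [s ->] := tau_span z; apply: big_ind. Qed.

Lemma product_ract z w d : F z (ract w d) = sa_mul (F z w) d.
Proof.
have rD := linear_morphD (ract_linear (b0 := Z) d).
have mD := linear_morphD (sa_mul_linearl (s := D) d).
elim/tau_ind: w => [|u v|x' y'].
- by rewrite (linear_morph0 (ract_linear d)) (linear_morph0 (F_linear z))
             (linear_morph0 (sa_mul_linearl d)).
- by rewrite rD !FDr mD => -> ->.
elim/tau_ind: z => [|u v|x y].
- by rewrite !F0l (linear_morph0 (sa_mul_linearl d)).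
- by rewrite !FDl mD => -> ->.
- by rewrite ract_tau !F_tau -lract_comm (rip_ract ip'P).
Qed.

Lemma product_lact z w b : F z (lact b w) = F (lact (sa_star b) z) w.
Proof.
have lD c := linear_morphD (lact_linear (b0 := Z) c).
have l0 c := linear_morph0 (lact_linear (b0 := Z) c).
elim/tau_ind: w => [|u v|x' y'].
- by rewrite l0 !(linear_morph0 (F_linear _)).
- by rewrite lD !FDr => -> ->.
elim/tau_ind: z => [|u v|x y].
- by rewrite l0 !F0l.
- by rewrite lD !FDl => -> ->.
- by rewrite !lact_tau !F_tau (rip_lact ipP).
Qed.

Hypothesis Xcyclic : orthogonal_cyclic_family (@ract R B A X) ip.

Lemma product_ge0 z : positive_elt (F z z).
Proof.
have [I [S [S0 Sdec Sorth Scyc]]] := Xcyclic.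
(* Normal form with at most one term per index. The families are total, with default value 0, which
   lies in every [S i]. *)
pose good z := exists (r : seq I) (x : I -> X) (y : I -> X'),
  [/\ uniq r, forall i, S i (x i) & z = \sum_(i <- r) tau (x i) (y i)].
have good0 : good 0.
  by exists [::], (fun=> 0), (fun=> 0); split=> //; rewrite big_nil.
have goodS i x y u : S i x -> good u -> good (tau x y + u).
  move=> Sx [r [x' [y' [ur Sx' ->]]]].
  have upd s v w : i \notin s ->
      \sum_(j <- s)
        tau (if j == i then v else x' j) (if j == i then w else y' j)
      = \sum_(j <- s) tau (x' j) (y' j).
    move=> is_; rewrite big_seq [RHS]big_seq; apply: eq_bigr => j js.
    by case: eqP js => // ->; rewrite (negPf is_).
  case: (boolP (i \in r)) => ir; last first.
    exists (i :: r), (fun j => if j == i then x else x' j),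
      (fun j => if j == i then y else y' j); split=> /=; first by rewrite ir.
      by move=> j; case: eqP => [->|].
    by rewrite big_cons eqxx upd.
  (* The index is already present: from [x = w a] and [x' i = w b], balancedness merges the two
     terms into [tau w (a y + b (y' i))]. *)
  have [w [a [b [Sw xE x'E]]]] := Scyc i x (x' i) Sx (Sx' i).
  exists r, (fun j => if j == i then w else x' j),
    (fun j => if j == i then lact a y + lact b (y' i) else y' j).
  split=> //; first by move=> j; case: eqP => [->|].
  rewrite (big_rem i) // [RHS](big_rem i) //= eqxx upd ?mem_rem_uniqF //.
  by rewrite tauDr -!tau_ract -xE -x'E addrA.
have goodX x y u : good u -> good (tau x y + u).
  have [s [Ss ->]] := Sdec x; rewrite (morphD_sum _ _ (tauDl y)).
  elim: s Ss => [|[i x'] s ih] Ss gu; first by rewrite big_nil add0r.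
  rewrite big_cons -addrA; apply: (goodS i).
    by apply: (Ss (i, x')); rewrite mem_head.
  by apply: ih => // p ps; apply: Ss; rewrite inE ps orbT.
have {good0 goodS goodX} [r [x [y [ur Sx ->]]]] : good z.
  have [s ->] := tau_span z; elim: s => [|p s ih]; first by rewrite big_nil.
  by rewrite big_cons; apply: goodX.
rewrite (morphD_sum _ _ (FDr _)).
(* Off-diagonal terms contain [ip (x j) (x i)], which is 0 by orthogonality since the indices in [r]
   are distinct. *)
have -> : \sum_(i <- r) F (\sum_(j <- r) tau (x j) (y j)) (tau (x i) (y i)) =
    \sum_(i <- r) ip' (y i) (lact (ip (x i) (x i)) (y i)).
  rewrite big_seq [RHS]big_seq; apply: eq_bigr => i ir.
  rewrite (morphD_sum _ _ (FDl _)) (bigD1_seq i) //= F_tau big1 ?addr0 //.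
  move=> j /eqP ji; rewrite F_tau (Sorth j i ji) //.
  by rewrite (linear_morph0 (lact_linearl _))
             (linear_morph0 (rip_linear ip'P _)).
apply: positive_elt_sum => i; apply: positive_elt_rip_lact => //.
exact: rip_ge0.
Qed.

Hypothesis X'_full :
  forall y : X', exists s : seq (A * X'), y = \sum_(p <- s) lact p.1 p.2.

Lemma product_full : spanning F.
Proof.
pose span (d : D) := exists s : seq (cext R * (Z * Z)),
  d = \sum_(t <- s) t.1 *: F t.2.1 t.2.2.
have span0 : span 0 by exists [::]; rewrite big_nil.
have spanD d e : span d -> span e -> span (d + e).
  by move=> [s ->] [t ->]; exists (s ++ t); rewrite big_cat.
have spanZ c d : span d -> span (c *: d).
  move=> [s ->]; exists [seq (c * t.1, t.2) | t <- s].
  by rewrite big_map scaler_sumr; apply: eq_bigr => t _; rewrite scalerA.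
have spanF z w : span (F z w).
  by exists [:: (1, (z, w))]; rewrite big_seq1 scale1r.
have span_sum J (s : seq J) G :
    (forall j, span (G j)) -> span (\sum_(j <- s) G j).
  by move=> Gs; elim/big_ind: _.
have lD (y : X') := linear_morphD (lact_linearl y).
have ipD (y : X') := linear_morphD (rip_linear ip'P y).
(* Expanding [a] in values of [ip] turns every term into a value of [F] at two vectors [tau x y]. *)
have span_lact y a y' : span (ip' y (lact a y')).
  have [s ->] := rip_full ipP a.
  rewrite (morphD_sum _ _ (lD y')) (morphD_sum _ _ (ipD y)).
  apply: span_sum => t; rewrite (linear_morphZ _ _ (lact_linearl y')).
  by rewrite (linear_morphZ _ _ (rip_linear ip'P y)) -F_tau; apply/spanZ.
(* Writing [y'] as a sum of vectors [lact a y''] supplies the factor from the algebra that a unit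
   would otherwise provide. *)
have span_ip y y' : span (ip' y y').
  have [s ->] := X'_full y'; rewrite (morphD_sum _ _ (ipD y)).
  by apply: span_sum => p.
move=> d; have [s ->] := rip_full ip'P d.
by apply: span_sum => t; apply/spanZ.
Qed.

Lemma product_right_inner_product : right_inner_product F.
Proof.
split=> //.
- exact: product_ract.
- exact: product_ge0.
- exact: product_lact.
- exact: product_full.
Qed.

End ProductOfInnerProducts.

(** * Condition P for the product, by induction in stages *)

(** Evaluates the form on an arbitrary presentation instead of the chosen representative, so that
    two such forms can be compared term by term. *)
Lemma rieffel_form_sum (R : realDomainType) (B A : star_algebra R)
    (X : bimodule B A) (ip : X -> X -> A) (H : star_representation A)
    (J : Type) (s : seq J) (x : J -> X) (h : J -> H) :
  right_inner_product ip ->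
  let u := \sum_(j <- s) pure (@ract R B A X) (@rep R A H) (x j) (h j) in
  rieffel_form ip u u =
    \sum_(j <- s) \sum_(j' <- s) ph_inner (h j') (rep (ip (x j') (x j)) (h j)).
Proof.
move=> ipP u.
have fDr w : {morph @rieffel_form R B A X ip H w : v v' / v + v'}.
  exact: (linear_morphD (W := (cext R)^o)
            (rieffel_form_linear (rip_linear ipP) (rip_ract ipP) w)).
have fDl w : {morph (@rieffel_form R B A X ip H)^~ w : v v' / v + v'}.
  move=> v v'; rewrite /= (rieffel_form_herm (rip_herm ipP)) fDr rmorphD /=.
  by rewrite -!(rieffel_form_herm (rip_herm ipP)).
rewrite (morphD_sum _ _ (fDr u)); apply: eq_bigr => j _.
rewrite (morphD_sum _ _ (fDl _)); apply: eq_bigr => j' _.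
by rewrite (rieffel_form_pure (rip_linear ipP) (rip_herm ipP) (rip_ract ipP)).
Qed.

(* For a representation [H] of [D], the form on [X' (x)_D H] is semidefinite,
   so its quotient [K] represents [A]; the form on [Z (x)_D H] is then pulled
   back from the form on [X (x)_A K]. *)
Section ProductPositivity.
Variables (R : realDomainType) (B A D : star_algebra R).
Variables (X : bimodule B A) (X' : bimodule A D) (Z : bimodule B D).
Variables (ip : X -> X -> A) (ip' : X' -> X' -> D) (F : Z -> Z -> D).
Variable tau : X -> X' -> Z.
Hypotheses (ipP : right_inner_product ip) (ip'P : right_inner_product ip').
Hypothesis FP : right_inner_product F.
Hypothesis tau_span :
  forall z, exists s : seq (X * X'), z = \sum_(p <- s) tau p.1 p.2.
Hypothesis F_tau : forall x y x' y',
  F (tau x y) (tau x' y') = ip' y (lact (ip x x') y').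
Hypotheses (ip_cond : condition_P ip) (ip'_cond : condition_P ip').

Section InducedRepresentation.
Variable H : star_representation D.
Local Notation V := (tensor (@ract R A D X') (@rep R D H)).

(** The form of Rieffel induction of [H] along [X']; condition P for [ip'] is its
    semidefiniteness. *)
Definition induced_form : semidefinite_form V :=
  @SemidefiniteForm R V (@rieffel_form R A D X' ip' H)
    (rieffel_form_linear (rip_linear ip'P) (rip_ract ip'P))
    (rieffel_form_herm (rip_herm ip'P)) (fun u => ip'_cond u).

Definition induced_act (a : A) : V -> V := tensor_map (lact a) id.

Fact induced_act_endo a : linear (induced_act a).
Proof.
apply: tensor_map_linear; [exact: (@lact_linear R A D X' a)|by []| |by []].
by move=> x d; rewrite lract_comm.
Qed.

Lemma induced_act_pure a y h :
  induced_act a (pure _ _ y h) = pure _ _ (lact a y) h.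
Proof.
apply: tensor_map_pure; [exact: (@lact_linear R A D X' a)|by []| |by []].
by move=> x d; rewrite lract_comm.
Qed.

Let actD a := linear_morphD (induced_act_endo a).
Let act0 a := linear_morph0 (induced_act_endo a).

Fact induced_act_linear u : linear (induced_act^~ u).
Proof.
move=> c a b; elim/tensor_ind: u => [|u v|y h].
- by rewrite !act0 scaler0 addr0.
- by rewrite !actD => -> ->; rewrite scalerDr addrACA.
- rewrite !induced_act_pure lact_linearl.
  by case: (pure_balanced (@ract R A D X') (@rep R D H)) => _ -> _.
Qed.

Fact induced_act_mul a b u :
  induced_act (sa_mul a b) u = induced_act a (induced_act b u).
Proof.
elim/tensor_ind: u => [|u v|y h].
- by rewrite !act0.
- by rewrite !actD => -> ->.
- by rewrite !induced_act_pure lact_mul.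
Qed.

Fact induced_act_star a u v :
  induced_form (induced_act a u) v = induced_form u (induced_act (sa_star a) v).
Proof.
elim/tensor_ind: v => [|v w|y' h'].
- by rewrite act0 !sf0r.
- by rewrite actD !sfDr => -> ->.
elim/tensor_ind: u => [|u w|y h].
- by rewrite act0 sf_herm [RHS]sf_herm !sf0r.
- by rewrite actD !sfDl => -> ->.
- have pE :=
    rieffel_form_pure (rip_linear ip'P) (rip_herm ip'P) (rip_ract ip'P).
  rewrite !induced_act_pure [LHS]pE [RHS]pE.
  by rewrite (rip_lact ip'P) sa_starK.
Qed.

Definition induced_representation : star_representation A :=
  quot_representation induced_act_endo induced_act_linear induced_act_mul
    induced_act_star.

End InducedRepresentation.

Lemma product_condition_P : condition_P F.
Proof.
move=> H U; pose K := induced_representation H.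
have [s ->] : exists s : seq (X * X' * H),
    U = \sum_(p <- s) pure _ _ (tau p.1.1 p.1.2) p.2.
  elim/tensor_ind: U => [|u v [s ->] [t ->]|z h].
  - by exists [::]; rewrite big_nil.
  - by exists (s ++ t); rewrite big_cat.
  - have [s ->] := tau_span z; exists [seq (p, h) | p <- s].
    by rewrite big_map (morphD_sum _ _ (pureDl _ _ h)).
pose k (y : X') (h : H) : K := \pi_(sf_quot (induced_form H)) (pure _ _ y h).
have := ip_cond
  (\sum_(p <- s) pure _ _ p.1.1 (k p.1.2 p.2) : tensor _ (@rep R A K)).
congr cge0.
rewrite !rieffel_form_sum //; apply: eq_bigr => p _; apply: eq_bigr => q _.
(* Termwise, [<k y h, (ip x x') (k y' h')>] equals [<h, (ip' y (ip x x' y')) h'>], and the algebra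
   element in the latter is [F (tau x y) (tau x' y')]. *)
rewrite [rep _ (k _ _)](quot_act_pi (induced_act_star (H := H))).
rewrite induced_act_pure [LHS]quot_inner_pi F_tau.
exact: (rieffel_form_pure (rip_linear ip'P) (rip_herm ip'P) (rip_ract ip'P)).
Qed.

End ProductPositivity.

(** * Spanning and conjugation of orthogonal cyclic families *)

Section OrthogonalCyclicFamilies.

(** Each component is a multiple of some vector: apply the last clause of the family to the
    component paired with itself. *)
Lemma cyclic_family_span (X A : zmodType) (act : X -> A -> X)
    (ip : X -> X -> A) (x : X) :
  orthogonal_cyclic_family act ip ->
  exists s : seq (X * A), x = \sum_(p <- s) act p.1 p.2.
Proof.
move=> [I [S [_ Sdec _ Scyc]]]; have [s [Ss ->]] := Sdec x.
elim: s Ss => [|[i y] s ih] Ss; first by exists [::]; rewrite !big_nil.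
have [|t tE] := ih; first by move=> p ps; apply: Ss; rewrite inE ps orbT.
have Sy : S i y by apply: (Ss (i, y)); rewrite mem_head.
have [z [a [_ [_ yE _]]]] := Scyc i y y Sy Sy.
by exists ((z, a) :: t); rewrite !big_cons /= -yE tE.
Qed.

(** The twisted action is the one on the conjugate bimodule; as the involution is onto, it yields
    the same multiples. *)
Lemma cyclic_family_star (R : realDomainType) (X : zmodType)
    (A : star_algebra R) (act : X -> A -> X) (ip : X -> X -> A) :
  orthogonal_cyclic_family act ip ->
  orthogonal_cyclic_family (fun x a => act x (sa_star a)) ip.
Proof.
move=> [I [S [S0 Sdec Sorth Scyc]]]; exists I, S; split=> // i x y Sx Sy.
have [z [a [b [Sz -> ->]]]] := Scyc i x y Sx Sy.
by exists z, (sa_star a), (sa_star b); rewrite !sa_starK.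
Qed.

End OrthogonalCyclicFamilies.

(** * The two inner products on tensor products *)

Section InnerProductsOnTensor.
Variables (R : realDomainType) (B A D : star_algebra R).
Variables (X : bimodule B A) (X' : bimodule A D).
Variables (ip : X -> X -> A) (ip' : X' -> X' -> D).
Hypotheses (ipP : right_inner_product ip) (ip'P : right_inner_product ip').

Definition product_kernel (x : X) (y : X') (x' : X) (y' : X') : D :=
  ip' y (lact (ip x x') y').

Fact product_kernel_herm x y x' y' :
  product_kernel x y x' y' = sa_star (product_kernel x' y' x y).
Proof.
rewrite /product_kernel (rip_lact ip'P) -(rip_herm ipP).
exact: rip_herm ip'P _ _.
Qed.

Fact product_kernel_balanced x y :
  balanced (@ract R B A X) (@lact R A D X') (product_kernel x y).
Proof.
rewrite /product_kernel; split=> [x' c y' z'|y' c x' z'|x' a y'].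
- by rewrite lact_linear (rip_linear ip'P).
- by rewrite (rip_linear ipP) (lact_linearl y') (rip_linear ip'P).
- by rewrite (rip_ract ipP) lact_mul.
Qed.

(** For the conjugate scalars the kernel is conjugate linear in [y'] and [x']; valued in
    [conj_module D] it becomes linear. *)
Definition conj_product_kernel (y : conj_bimodule X') (x : conj_bimodule X)
    (y' : conj_bimodule X') (x' : conj_bimodule X) : conj_module D :=
  product_kernel x y x' y'.

Fact conj_product_kernel_herm y x y' x' :
  conj_product_kernel y x y' x' = sa_star (conj_product_kernel y' x' y x).
Proof. exact: product_kernel_herm. Qed.

Fact conj_product_kernel_balanced y x :
  balanced (@ract R D A (conj_bimodule X')) (@lact R A B (conj_bimodule X))
    (conj_product_kernel y x).
Proof.
rewrite /conj_product_kernel /product_kernel.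
split=> [y' c x' z'|x' c y' z'|y' a x'].
- rewrite [ip x _](rip_linear ipP x (cconj c) x' z').
  by rewrite (lact_linearl (y' : X')) (rip_linear ip'P).
- have /(congr1 (ip' y)) :=
    lact_linear (b0 := X') (ip x x') (cconj c) (y' : X') (z' : X').
  by rewrite (rip_linear ip'P).
- by rewrite /= /conj_lact /conj_ract (rip_ract ipP) lact_mul.
Qed.

Hypotheses (ip_cond : condition_P ip) (ip'_cond : condition_P ip').
Hypothesis Xcyclic : orthogonal_cyclic_family (@ract R B A X) ip.
Hypothesis X'_full :
  forall y : X', exists s : seq (A * X'), y = \sum_(p <- s) lact p.1 p.2.

Definition tensor_rip (u v : tensor_bimodule X X') : D :=
  tensor_form product_kernel u v.

Lemma tensor_rip_pure x y x' y' :
  tensor_rip (pure _ _ x y) (pure _ _ x' y') = product_kernel x y x' y'.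
Proof.
exact: (tensor_form_pure (@starD R D) product_kernel_balanced
         product_kernel_herm).
Qed.

Let Z := tensor_bimodule X X'.

Lemma tensor_ripP : right_inner_product tensor_rip /\ condition_P tensor_rip.
Proof.
have tau_span (z : Z) : exists s : seq (X * X'),
    z = \sum_(p <- s) (pure _ _ p.1 p.2 : Z).
  by exists (repr z); rewrite -tensor_sum_pure.
have FP : right_inner_product tensor_rip.
  apply: (product_right_inner_product ipP ip'P
           (tau := fun x y => pure _ _ x y : Z)) => //.
  - exact: pureDl.
  - exact: pureDr.
  - exact: pure_act.
  - by move=> b x y; exact: tensor_lact_pure.
  - by move=> x y d; exact: tensor_ract_pure.
  - by move=> z; exact: (tensor_form_linear product_kernel_balanced).
  - by move=> u v; exact: (tensor_form_herm (@starD R D) product_kernel_herm).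
  - exact: tensor_rip_pure.
split=> //.
apply: (product_condition_P ipP ip'P FP tau_span) => //.
exact: tensor_rip_pure.
Qed.

Let cZ := tensor_bimodule (conj_bimodule X') (conj_bimodule X).

Definition tensor_lip (u v : cZ) : D :=
  tensor_form conj_product_kernel u v.

Lemma tensor_lip_pure y x y' x' :
  tensor_lip (pure _ _ y x) (pure _ _ y' x') = product_kernel x y x' y'.
Proof.
exact: (tensor_form_pure (V := conj_module D) (@starD R D)
  conj_product_kernel_balanced conj_product_kernel_herm).
Qed.

Let cr := @ract R D A (conj_bimodule X').
Let cl := @lact R A B (conj_bimodule X).
Let cpure (x : X) (y : X') : conj_bimodule cZ :=
  pure cr cl y x.

Lemma tensor_lipP : left_inner_product tensor_lip /\
  condition_P (X := conj_bimodule cZ) tensor_lip.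
Proof.
have tau_span (z : conj_bimodule cZ) : exists s : seq (X * X'),
    z = \sum_(p <- s) cpure p.1 p.2.
  exists [seq (p.2, p.1) | p <- repr (z : cZ)]; rewrite big_map.
  exact: tensor_sum_pure.
have FP : right_inner_product (X := conj_bimodule cZ) tensor_lip.
  apply: (product_right_inner_product ipP ip'P (tau := cpure)) => //.
  - by move=> y; exact: (pureDr cr cl y).
  - by move=> x; exact: (pureDl cr cl x).
  - move=> x a y.
    (* Both actions on the conjugates carry a star, so the balancing relation is taken at
       [sa_star a]. *)
    have : cpure (ract x (sa_star (sa_star a))) y =
           cpure x (lact (sa_star (sa_star a)) y).
      exact: esym (pure_act cr cl y (sa_star a) x).
    by rewrite sa_starK.
  - move=> b x y; rewrite /= /conj_lact [LHS]tensor_ract_pure.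
    by rewrite /= /conj_ract sa_starK.
  - move=> x y d; rewrite /= /conj_ract [LHS]tensor_lact_pure.
    by rewrite /= /conj_lact sa_starK.
  - move=> z c u v.
    (* The scalar is conjugated once in [conj_bimodule cZ] and once more in [conj_module D]. *)
    have := tensor_form_linear conj_product_kernel_balanced z (cconj c) u v.
    by rewrite /GRing.scale /= /conj_scale !cconjK.
  - move=> u v; exact: (tensor_form_herm (V := conj_module D) (@starD R D)
      conj_product_kernel_herm).
  - by move=> x y x' y'; exact: tensor_lip_pure.
split; first exact/conj_inner_productP.
apply: (product_condition_P ipP ip'P FP tau_span) => //.
by move=> x y x' y'; exact: tensor_lip_pure.
Qed.

End InnerProductsOnTensor.

(** * Compatibility of the inner products, and the equivalence bimodule *)

(** Put [a = <y3, y2> <x2, x1>] in [A]. In terms of the original actions, [eb_compat] for [X'] makes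
    the left side the pure tensor of [a y1] and [x3], and [eb_compat] for [X] makes the right side
    that of [y1] and [x3 a]; balancing over [A] identifies them. *)
Lemma tensor_compat_pure (R : realDomainType) (A B D : star_algebra R)
    (X : equivalence_bimodule B A) (X' : equivalence_bimodule A D)
    (y1 y2 y3 : conj_bimodule X') (x1 x2 x3 : conj_bimodule X) :
  let p := pure (@ract R D A (conj_bimodule X'))
                (@lact R A B (conj_bimodule X)) in
  p (lact (product_kernel (@ipr R B A X) (@ipr R A D X') x1 y1 x2 y2) y3) x3 =
  p y1 (ract x1 (product_kernel (X := conj_bimodule X') (X' := conj_bimodule X)
                   (@ipl R A D X') (@ipl R B A X) y2 x2 y3 x3)).
Proof.
move=> p; pose a : A := sa_mul (ipl (y3 : X') y2) (ipr (x2 : X) x1).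
have -> : ract x1 (product_kernel (X := conj_bimodule X')
    (X' := conj_bimodule X) (@ipl R A D X') (@ipl R B A X) y2 x2 y3 x3) =
    lact (sa_star a) x3.
  rewrite /product_kernel /= /conj_ract /conj_lact.
  rewrite -(lip_herm (eb_left X)) eb_compat -(lip_herm (eb_left X')).
  by rewrite sa_starK ract_mul.
have -> : lact (product_kernel (@ipr R B A X) (@ipr R A D X') x1 y1 x2 y2) y3 =
    ract y1 (sa_star a).
  rewrite /product_kernel /= /conj_ract /conj_lact.
  rewrite -(rip_herm (eb_right X')) -eb_compat sa_starK (lip_herm (eb_left X')).
  rewrite (lip_lact (eb_left X')) sa_starM -(rip_herm (eb_right X)).
  by rewrite -(lip_herm (eb_left X')).
exact: pure_act.
Qed.

Theorem proposition5p6 (R : realDomainType) (A B D : star_algebra R)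
  (X : equivalence_bimodule B A) (X' : equivalence_bimodule A D)
  (hX : conditions_P1_P3 X) (hX' : conditions_Q1_Q3 X') :
  formally_Morita_equivalent B D.
Proof.
have XP := eb_right X; have X'P := eb_right X'.
have cXP := proj2 (conj_inner_productP _) (eb_left X).
have cX'P := proj2 (conj_inner_productP _) (eb_left X').
have Xcyc := pseudo_cyclic_family hX.
have X'cyc := pseudo_cyclic_family hX'.
have X'full (y : X') : exists s : seq (A * X'), y = \sum_(p <- s) lact p.1 p.2.
  have [s ->] := cyclic_family_span y X'cyc.
  by exists [seq (p.2, p.1) | p <- s]; rewrite big_map.
have cXfull (x : conj_bimodule X) : exists s : seq (A * conj_bimodule X),
    x = \sum_(p <- s) lact p.1 p.2.
  have [s ->] := cyclic_family_span x (cyclic_family_star Xcyc).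
  by exists [seq (p.2, p.1) | p <- s]; rewrite big_map.
(* Each decomposition serves twice: here that of [X'] gives positivity and that of [X] gives
   fullness, and for [tensor_lipP] the roles are exchanged. *)
have [rP rcond] := tensor_ripP cX'P cXP (@eb_Q _ _ _ X') (@eb_Q _ _ _ X)
  (cyclic_family_star X'cyc) cXfull.
have [lP lcond] :=
  tensor_lipP XP X'P (@eb_P _ _ _ X) (@eb_P _ _ _ X') Xcyc X'full.
(* [formally_Morita_equivalent B D] asks for a bimodule with [D] on the left and [B] on the right,
   hence the conjugates in reverse order. *)
pose Z := tensor_bimodule (conj_bimodule X') (conj_bimodule X).
constructor; apply: (@EquivalenceBimodule R D B Z _ _ rP lP) => //.
have rD u := linear_morphD (rip_linear rP u).
have rDl u := ripDl rP u.
have lD u := linear_morphD (lip_linear lP u).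
have lDr := ripDr (proj2 (conj_inner_productP _) lP).
have lactDl u := linear_morphD (@lact_linearl R D B Z u).
have ractDr u := linear_morphD (@ract_linearr R D B Z u).
have lactD b := linear_morphD (@lact_linear R D B Z b).
have ractD b := linear_morphD (@ract_linear R D B Z b).
(* Both sides are additive in each of the three arguments, which reduces the identity to pure
   tensors. *)
move=> u v w; move: w.
apply: tensor_eq_morphD => [|w w'|y3 x3]; first exact: lactD.
  by rewrite rD ractDr.
move: v; apply: tensor_eq_morphD => [v v'|v v'|y2 x2].
- by rewrite lDr lactDl.
- by rewrite rDl ractDr.
move: u; apply: tensor_eq_morphD => [u u'||y1 x1].
- by rewrite lD lactDl.
- exact: ractD.
rewrite tensor_lip_pure // tensor_rip_pure //.
rewrite [LHS]tensor_lact_pure [RHS]tensor_ract_pure.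
exact: tensor_compat_pure.
Qed.
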